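(* Let $V$ be an almost-equidistant set in $\mathbb R^d$ and let $G=(V,E)$ be its unit distance graph. Let $k\geq 1$ and let $\mathbf w_0,\mathbf w_1,\dots,\mathbf w_k$ be distinct vertices of $G$. Put \[ s:=\sum_{i=1}^k\left(\|\mathbf w_0-\mathbf w_i\|^2-1\right) \] and assume that $|s|\geq\sqrt{k}$. Then the number of vertices of $G$ adjacent to all of $\mathbf w_0,\mathbf w_1,\dots,\mathbf w_k$ is at most $2d+2$.
   Context: A finite set of points in $\mathbb R^d$ (with the Euclidean norm $\|\cdot\|$) is called almost-equidistant if among any three distinct points in the set, some two are at distance exactly $1$. The unit distance graph $G=(V,E)$ of $V$ has the points of $V$ as vertices, and its edges are the pairs of vertices at distance exactly $1$ apart. *)

(* Defs.v *)
From mathcomp Require Import all_boot all_order all_algebra.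
From mathcomp Require Import finmap.
From mathcomp Require Import reals.

Set Implicit Arguments.
Unset Strict Implicit.
Unset Printing Implicit Defensive.

Import Order.TTheory GRing.Theory Num.Theory.
Local Open Scope ring_scope.

(* MathComp-Analysis equips 'rV[R]_d with the sup norm, hence an explicit
   Euclidean norm. *)
Definition enorm (R : realType) (d : nat) (x : 'rV[R]_d) : R :=
  Num.sqrt (\sum_(j < d) x 0 j ^+ 2).

Definition almost_equidistant (R : realType) (d : nat)
    (V : {fset 'rV[R]_d}) : Prop :=
  forall x y z : 'rV[R]_d, x \in V -> y \in V -> z \in V ->
    x != y -> y != z -> x != z ->
    [\/ enorm (x - y) = 1, enorm (y - z) = 1 | enorm (x - z) = 1].

(* The adjacency relation of the graph with vertex set V; it is false off V. *)
Definition unit_distance_graph (R : realType) (d : nat)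
    (V : {fset 'rV[R]_d}) : rel 'rV[R]_d :=
  fun x y => [&& x \in V, y \in V & enorm (x - y) == 1].

(* Main.v *)
Require Import Defs.
From mathcomp Require Import all_boot all_order all_algebra.
From mathcomp Require Import finmap.
From mathcomp Require Import reals.
From mathcomp Require Import ring lra.

Set Implicit Arguments.
Unset Strict Implicit.
Unset Printing Implicit Defensive.

Import Order.TTheory GRing.Theory Num.Theory.
Local Open Scope fset_scope.
Local Open Scope ring_scope.

(** Put the w_i that are not at distance 1 from w_0 into a set A.  Dropping the
    other w_i changes neither s nor the hypothesis (|A| <= k), and almost
    equidistance applied to w_0 and two members of A makes A a unit clique.
    With w_0 as origin write u_i for w_i - w_0, U for the sum of the u_i over A
    and t for the sum of the |u_i|^2, so that s = t - |A|.  As the u_i are at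
    mutual distance 1, |U|^2 is a function of t and |A|, and s^2 >= |A| turns
    out to be the inequality 2 |U|^2 <= t^2 ([dot_sum_unit_clique]).

    A common neighbour v satisfies 2 <v - w_0, U> = t, that is, it lies on a
    fixed hyperplane, and also on the unit sphere about w_0.  These meet in a
    sphere with centre w_0 + (t / (2 |U|^2)) U and squared radius
    1 - t^2 / (4 |U|^2) <= 1/2 ([common_neighbours_small_sphere]).

    Points v on a sphere with centre p and squared radius r2 <= 1/2 lift to the
    unit vectors (sqrt 2 (v - p), sqrt (1 - 2 r2)) of dimension d + 1, and unit
    distance becomes orthogonality ([card_small_sphere]).  Rosenfeld's theorem
    says that unit vectors in dimension m, two of any three of which are
    orthogonal, number at most 2m ([rosenfeld]); here m = d + 1. *)

(** * Rosenfeld's theorem on almost orthogonal unit vectors *)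

Lemma mxtrace_mulmx_trmx_ge0 (R : realFieldType) (m n : nat)
    (B : 'M[R]_(m, n)) :
  0 <= \tr (B *m B^T).
Proof.
apply: sumr_ge0 => i _; rewrite mxE; apply: sumr_ge0 => j _.
by rewrite mxE -expr2 sqr_ge0.
Qed.

Lemma mxtrace_cube (R : comNzRingType) (n : nat) (A : 'M[R]_n) :
  \tr (A *m A *m A) = \sum_i \sum_j \sum_l A i j * A j l * A l i.
Proof.
apply: eq_bigr => i _; rewrite mxE.
under eq_bigr => l _ do rewrite mxE mulr_suml.
by rewrite exchange_big.
Qed.

(** In terms of an eigenvalue x of P, this is the factorization
    (x - 1)^3 - 3 (x - 1) = x (x - 2)^2 + (x - 2)^2 - 2: the matrices M and P
    have the same nonzero eigenvalues, and the terms in n and m account for the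
    zero ones.  Writing it with traces keeps spectral theory out of the proof:
    both traces on the right are visibly nonnegative. *)
Lemma mxtrace_gram_poly (R : comNzRingType) (n m : nat) (Y : 'M[R]_(n, m)) :
    let M := Y *m Y^T in let P := Y^T *m Y in
    let Q := P - 2%:R%:M in
  \tr ((M - 1%:M) *m (M - 1%:M) *m (M - 1%:M)) - \tr (M - 1%:M) *+ 3 =
  \tr ((Y *m Q) *m (Y *m Q)^T) + \tr (Q *m Q^T) - m%:R *+ 4 + n%:R *+ 2.
Proof.
move=> M P Q.
have PT : P^T = P by rewrite trmx_mul trmxK.
have QT : Q^T = Q by rewrite linearB /= PT tr_scalar_mx.
have trM : \tr M = \tr P by rewrite mxtrace_mulC.
have trM2 : \tr (M *m M) = \tr (P *m P).
  by rewrite /M /P -mulmxA mxtrace_mulC !mulmxA.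
have trM3 : \tr (M *m M *m M) = \tr (P *m P *m P).
  by rewrite /M /P -!mulmxA mxtrace_mulC !mulmxA.
have -> : \tr (Y *m Q *m (Y *m Q)^T) = \tr (Q *m P *m Q).
  by rewrite trmx_mul QT mxtrace_mulC /P !mulmxA.
rewrite QT /Q.
rewrite !(mulmxBl, mulmxBr, mul_scalar_mx, mul_mx_scalar, scale1r).
rewrite -!scalemxAl !scaler_nat mulrnBl.
rewrite !raddfB /= !raddfMn /= !mxtrace_scalar.
by rewrite trM3 trM2 trM; ring.
Qed.

(** The matrix M - 1 is supported on the nonorthogonal pairs, a triangle-free
    graph, so that M - 1 and its cube have trace 0.  The left-hand side of
    [mxtrace_gram_poly] then vanishes, leaving 2n <= 4m. *)
Lemma rosenfeld (R : realFieldType) (n m : nat) (Y : 'M[R]_(n, m)) :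
    (forall i, (Y *m Y^T) i i = 1) ->
    (forall i j l, i != j -> j != l -> i != l ->
      [\/ (Y *m Y^T) i j = 0, (Y *m Y^T) j l = 0 | (Y *m Y^T) i l = 0]) ->
  (n <= 2 * m)%N.
Proof.
move=> unitY orthY.
set M := Y *m Y^T in unitY orthY *.
have MT : M^T = M by rewrite trmx_mul trmxK.
have MC i j : M i j = M j i by rewrite -{1}MT mxE.
have diag0 i : (M - 1%:M) i i = 0.
  by rewrite [LHS]mxE [X in _ + X]mxE [X in - X]mxE eqxx unitY subrr.
have offdiag i j : i != j -> (M - 1%:M) i j = M i j.
  by move=> /negbTE ij; rewrite [LHS]mxE [X in _ + X]mxE [X in - X]mxE ij oppr0 addr0.
have tr1 : \tr (M - 1%:M) = 0 by apply: big1 => i _; exact: diag0.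
have tr3 : \tr ((M - 1%:M) *m (M - 1%:M) *m (M - 1%:M)) = 0.
  rewrite mxtrace_cube; apply: big1 => i _; apply: big1 => j _.
  apply: big1 => l _.
  have [->|ij] := eqVneq i j; first by rewrite diag0 !mul0r.
  have [->|jl] := eqVneq j l; first by rewrite diag0 mulr0 mul0r.
  have [->|il] := eqVneq i l; first by rewrite diag0 mulr0.
  have li : l != i by rewrite eq_sym.
  rewrite !offdiag //; have [->|->|e] := orthY i j l ij jl il.
  - by rewrite !mul0r.
  - by rewrite mulr0 mul0r.
  - by rewrite [M l i]MC e mulr0.
have := mxtrace_gram_poly Y; rewrite /= -/M tr1 tr3.
set Q := Y^T *m Y - _.
have ge1 := mxtrace_mulmx_trmx_ge0 (Y *m Q).
have ge2 := mxtrace_mulmx_trmx_ge0 Q.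
move=> trE; rewrite -(ler_nat R) natrM; lra.
Qed.

(** * The Euclidean inner product *)

Definition dot (R : realType) (d : nat) (x y : 'rV[R]_d) : R :=
  \sum_(j < d) x 0 j * y 0 j.

Lemma dotC (R : realType) (d : nat) (x y : 'rV[R]_d) : dot x y = dot y x.
Proof. by apply: eq_bigr => j _; rewrite mulrC. Qed.

Lemma dotDl (R : realType) (d : nat) (x y z : 'rV[R]_d) :
  dot (x + y) z = dot x z + dot y z.
Proof.
by rewrite -big_split; apply: eq_bigr => j _; rewrite mxE mulrDl.
Qed.

Lemma dotZl (R : realType) (d : nat) (a : R) (x z : 'rV[R]_d) :
  dot (a *: x) z = a * dot x z.
Proof. by rewrite mulr_sumr; apply: eq_bigr => j _; rewrite mxE mulrA. Qed.

Lemma dotBl (R : realType) (d : nat) (x y z : 'rV[R]_d) :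
  dot (x - y) z = dot x z - dot y z.
Proof. by rewrite -scaleN1r dotDl dotZl mulN1r. Qed.

Lemma dotBr (R : realType) (d : nat) (x y z : 'rV[R]_d) :
  dot z (x - y) = dot z x - dot z y.
Proof. by rewrite dotC dotBl !(dotC _ z). Qed.

Lemma dotZr (R : realType) (d : nat) (a : R) (x z : 'rV[R]_d) :
  dot z (a *: x) = a * dot z x.
Proof. by rewrite dotC dotZl dotC. Qed.

Lemma dot_sqrB (R : realType) (d : nat) (x y : 'rV[R]_d) :
  dot (x - y) (x - y) = dot x x - 2 * dot x y + dot y y.
Proof. by rewrite dotBl !dotBr (dotC y x); ring. Qed.

Lemma dot_suml (R : realType) (d : nat) (I : finType) (P : pred I)
    (u : I -> 'rV[R]_d) (z : 'rV[R]_d) :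
  dot (\sum_(i | P i) u i) z = \sum_(i | P i) dot (u i) z.
Proof.
rewrite exchange_big; apply: eq_bigr => j _.
by rewrite summxE mulr_suml.
Qed.

Lemma dot_ge0 (R : realType) (d : nat) (x : 'rV[R]_d) : 0 <= dot x x.
Proof. by apply: sumr_ge0 => j _; rewrite -expr2 sqr_ge0. Qed.

Lemma dot_eq0 (R : realType) (d : nat) (x : 'rV[R]_d) :
  (dot x x == 0) = (x == 0).
Proof.
apply/eqP/eqP => [x0|->]; last by apply: big1 => j _; rewrite mxE mul0r.
apply/rowP => j; rewrite [RHS]mxE; apply/eqP; rewrite -sqrf_eq0.
have /psumr_eq0P := x0; rewrite expr2 => -> // l _.
by rewrite -expr2 sqr_ge0.
Qed.

Lemma enorm_sqr (R : realType) (d : nat) (x : 'rV[R]_d) :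
  enorm x ^+ 2 = dot x x.
Proof. exact/sqr_sqrtr/dot_ge0. Qed.

Lemma enorm_eq1 (R : realType) (d : nat) (x : 'rV[R]_d) :
  (enorm x == 1) = (dot x x == 1).
Proof. by rewrite -enorm_sqr sqrp_eq1 // sqrtr_ge0. Qed.

(** * Points on a sphere of squared radius at most 1/2 *)

(** The extra coordinate of the lift raises the common norm to 1.  Two points at
    distance 1 on the sphere have <v_i - p, v_j - p> = r2 - 1/2, which the extra
    coordinate cancels exactly. *)
Lemma card_small_sphere (R : realType) (d n : nat) (v : 'I_n -> 'rV[R]_d)
    (p : 'rV[R]_d) (r2 : R) :
    2 * r2 <= 1 -> (forall i, dot (v i - p) (v i - p) = r2) ->
    (forall i j l, i != j -> j != l -> i != l ->
      [\/ enorm (v i - v j) = 1, enorm (v j - v l) = 1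
        | enorm (v i - v l) = 1]) ->
  (n <= 2 * d + 2)%N.
Proof.
move=> r2_le sph ae.
pose Y : 'M[R]_(n, d + 1) := row_mx
  (\matrix_(i, j) (Num.sqrt 2 * (v i - p) 0 j)) (const_mx (Num.sqrt (1 - 2 * r2))).
have gramE i j : (Y *m Y^T) i j = 2 * dot (v i - p) (v j - p) + (1 - 2 * r2).
  rewrite tr_row_mx mul_row_col [LHS]mxE; congr (_ + _); last first.
    by rewrite mxE big_ord1 !mxE -expr2 sqr_sqrtr // subr_ge0.
  rewrite mxE mulr_sumr; apply: eq_bigr => l _; rewrite !mxE.
  by rewrite mulrACA -expr2 sqr_sqrtr.
have gram0 i j : enorm (v i - v j) = 1 -> (Y *m Y^T) i j = 0.
  move/eqP; rewrite enorm_eq1.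
  have -> : v i - v j = (v i - p) - (v j - p) by rewrite opprB addrA subrK.
  rewrite dot_sqrB !sph gramE => /eqP; lra.
have -> : (2 * d + 2 = 2 * (d + 1))%N by rewrite mulnDr.
apply: (rosenfeld (Y := Y)) => [i | i j l ij jl il].
  by rewrite gramE sph; lra.
by case: (ae i j l ij jl il) => /gram0 e;
  [exact: Or31 | exact: Or32 | exact: Or33].
Qed.

(** * The sphere of common neighbours *)

(** Polarization: 2 <u_i, u_j> = |u_i|^2 + |u_j|^2 - 1 for i != j, and the
    diagonal terms are off from this formula by 1 each. *)
Lemma dot_sum_unit_clique (R : realType) (d : nat) (I : finType) (A : {set I})
    (u : I -> 'rV[R]_d) :
    {in A &, forall i j, i != j -> dot (u i - u j) (u i - u j) = 1} ->
  2 * dot (\sum_(i in A) u i) (\sum_(i in A) u i) =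
  2 * #|A|%:R * (\sum_(i in A) dot (u i) (u i)) - #|A|%:R ^+ 2 + #|A|%:R.
Proof.
move=> clq; set t := \sum_(i in A) dot (u i) (u i).
have pairE i j : i \in A -> j \in A -> 
    2 * dot (u i) (u j) = dot (u i) (u i) + dot (u j) (u j) - 1 + (i == j)%:R.
  move=> iA jA; have [->|/(clq i j iA jA)] := eqVneq i j; first by rewrite /=; ring.
  rewrite dot_sqrB /=; lra.
rewrite dot_suml mulr_sumr.
transitivity (\sum_(i in A) (#|A|%:R * dot (u i) (u i) + t - #|A|%:R + 1)).
  apply: eq_bigr => i iA; rewrite dotC dot_suml mulr_sumr.
  rewrite (eq_bigr (fun j => dot (u i) (u i) + dot (u j) (u j) - 1 + (i == j)%:R)).
    rewrite big_split sumrB big_split /= !sumr_const -/t.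
    rewrite (bigD1 i) //= eqxx big1 ?addr0 ?mulr_natl //.
    by move=> j /andP[_ /negbTE ji]; rewrite eq_sym ji.
  by move=> j jA; rewrite dotC pairE.
rewrite !big_split /= -mulr_sumr !sumr_const -/t -mulr_natl -[(- _) *+ _]mulr_natl; ring.
Qed.

(** Subtracting |v - w_i|^2 = 1 from |v - w_0|^2 = 1 gives
    2 <v - w_0, u_i> = |u_i|^2, and summing over A puts every v of N on the
    hyperplane 2 <v - w_0, U> = t.  The set N may be empty, in which case U can
    vanish: w_0 may be the centroid of the clique. *)
Lemma common_neighbours_small_sphere (R : realType) (d : nat) (I : finType)
    (A : {set I}) (w0 : 'rV[R]_d) (w : I -> 'rV[R]_d) (N : pred 'rV[R]_d) :
    {in A &, forall i j, i != j -> enorm (w i - w j) = 1} ->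
    (exists2 i, i \in A & w i != w0) ->
    #|A|%:R <= (\sum_(i in A) (enorm (w0 - w i) ^+ 2 - 1)) ^+ 2 ->
    (forall v, N v -> enorm (v - w0) = 1) ->
    (forall v i, N v -> i \in A -> enorm (v - w i) = 1) ->
  exists p r2, 2 * r2 <= 1 /\ forall v, N v -> dot (v - p) (v - p) = r2.
Proof.
move=> clq [i0 i0A wi0] s_ge Nw0 Nw.
pose u i := w i - w0; pose U := \sum_(i in A) u i.
pose t := \sum_(i in A) dot (u i) (u i).
have t_gt0 : 0 < t.
  rewrite /t (bigD1 i0) //= ltr_pwDl //; last by apply: sumr_ge0 => i _; exact: dot_ge0.
  by rewrite lt_def dot_ge0 dot_eq0 subr_eq0 wi0.
have sE : \sum_(i in A) (enorm (w0 - w i) ^+ 2 - 1) = t - #|A|%:R.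
  rewrite sumrB sumr_const; congr (_ - _); apply: eq_bigr => i _.
  by rewrite enorm_sqr /u !dot_sqrB (dotC w0); ring.
have qE : 2 * dot U U = 2 * #|A|%:R * t - #|A|%:R ^+ 2 + #|A|%:R.
  apply: dot_sum_unit_clique => i j iA jA ij; apply/eqP.
  by rewrite /u opprB addrA subrK -enorm_eq1 clq.
have q_le : 2 * dot U U <= t ^+ 2.
  by move: s_ge; rewrite sE qE sqrrB -mulr_natl; lra.
have dotU v : N v -> 2 * dot (v - w0) U = t.
  move=> Nv; rewrite dotC dot_suml mulr_sumr; apply: eq_bigr => i iA.
  have /eqP := Nw v i Nv iA; have /eqP := Nw0 v Nv; rewrite !enorm_eq1.
  have -> : v - w i = (v - w0) - u i by rewrite /u opprB addrA subrK.
  move=> /eqP v1; rewrite dot_sqrB v1 (dotC (v - w0)) => /eqP; lra.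
(* A point of N would give 0 = 2 <v - w_0, U> = t > 0, so that N is empty and
   any sphere will do. *)
have [U0|U_neq0] := eqVneq U 0.
  exists 0, 0; split=> [|v /dotU tE]; first by rewrite mulr0.
  have z : dot (v - w0) U = 0 by rewrite U0 -(scale0r U) dotZr mul0r.
  by move: tE t_gt0; rewrite z mulr0 => <-; rewrite ltxx.
have q_gt0 : 0 < dot U U by rewrite lt_def dot_ge0 dot_eq0 U_neq0.
pose c := t / (2 * dot U U).
have cE : c * (2 * dot U U) = t by rewrite /c mulfVK // mulf_neq0 // lt0r_neq0.
exists (w0 + c *: U), (1 - c * t / 2); split.
  have : 1 <= c * t.
    by rewrite /c mulrAC ler_pdivlMr ?mulr_gt0 // mul1r -expr2.
  by move=> h; lra.
move=> v Nv; rewrite opprD addrA.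
have /eqP := Nw0 v Nv; rewrite enorm_eq1 => /eqP v1.
rewrite dot_sqrB !(dotZl, dotZr) v1.
have := dotU v Nv; set y := dot (v - w0) U => yE.
have -> : y = t / 2 by lra.
have -> : c * (c * dot U U) = c * (c * (2 * dot U U)) / 2 by field.
by rewrite cE; field.
Qed.

Theorem lemma7 (R : realType) (d : nat) (V : {fset 'rV[R]_d})
    (V_ae : almost_equidistant V)
    (k : nat) (k_ge1 : (1 <= k)%N)
    (w : 'I_k.+1 -> 'rV[R]_d)
    (w_inj : injective w) (w_in : forall i, w i \in V)
    (s : R)
    (s_def : s = \sum_(i < k.+1 | (1 <= i)%N)
                   (enorm (w ord0 - w i) ^+ 2 - 1))
    (s_ge : Num.sqrt k%:R <= `|s|) :
  (#|` [fset v in V | [forall i : 'I_k.+1, unit_distance_graph V v (w i)]] |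
     <= 2 * d + 2)%N.
Proof.
set N := [fset _ in _ | _].
have NV v : v \in N -> v \in V by rewrite !inE => /andP[].
have Nw v i : v \in N -> enorm (v - w i) = 1.
  by rewrite !inE => /andP[_ /forallP /(_ i) /and3P[_ _ /eqP]].
pose A := [set i : 'I_k.+1 | (1 <= i)%N & enorm (w ord0 - w i) != 1].
have A_neq0 i : i \in A -> w i != w ord0.
  by rewrite inE => /andP[i_ge1 _]; rewrite (inj_eq w_inj) -lt0n.
have clq : {in A &, forall i j, i != j -> enorm (w i - w j) = 1}.
  move=> i j iA jA ij; have := V_ae _ _ _ (w_in ord0) (w_in i) (w_in j).
  rewrite !(inj_eq w_inj) !(eq_sym ord0) -!(inj_eq w_inj).
  rewrite !A_neq0 // (inj_eq w_inj) ij => /(_ isT isT isT).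
  by move: iA jA; rewrite !inE => /andP[_ /eqP?] /andP[_ /eqP?] [].
have sE : s = \sum_(i in A) (enorm (w ord0 - w i) ^+ 2 - 1).
  rewrite s_def (bigID (fun i => enorm (w ord0 - w i) != 1)) /=.
  rewrite [X in _ + X]big1 ?addr0 => [|i /andP[_ /negPn /eqP ->]].
    by apply: eq_bigl => i; rewrite inE.
  by rewrite expr1n subrr.
have s2_ge : k%:R <= s ^+ 2.
  rewrite -(@sqr_sqrtr _ k%:R) // -(real_normK (num_real s)).
  by rewrite lerXn2r // nnegrE // sqrtr_ge0.
have A_le : (#|A| <= k)%N.
  have cardC0 : #|[set~ ord0 : 'I_k.+1]| = k by rewrite cardsC1 card_ord.
  rewrite -[leqRHS]cardC0; apply/subset_leq_card/subsetP => i iA; rewrite !inE.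
  by rewrite -(inj_eq w_inj) A_neq0.
have [i0 i0A] : exists i, i \in A.
  apply/set0Pn/eqP => A0; move: s2_ge; rewrite sE A0 big_set0 expr0n /= lern0.
  by rewrite eqn0Ngt k_ge1.
have A_s : #|A|%:R <= (\sum_(i in A) (enorm (w ord0 - w i) ^+ 2 - 1)) ^+ 2.
  by rewrite -sE (le_trans _ s2_ge) // ler_nat.
have [p [r2 [r2_le sph]]] := common_neighbours_small_sphere clq
  (ex_intro2 _ _ i0 i0A (A_neq0 i0 i0A)) A_s (Nw^~ ord0)
  (fun v i Nv _ => Nw v i Nv).
(* The default 0 of nth is never reached, as the indices are below #|` N|. *)
pose v (i : 'I_#|` N|) := nth 0 (enum_fset N) i.
have vN i : v i \in N by exact: mem_nth.
have v_neq i j : (v i == v j) = (i == j) by rewrite nth_uniq ?fset_uniq.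
apply: (card_small_sphere (v := v) r2_le) => [i|i j l ij jl il]; first exact: sph.
by apply: V_ae; rewrite ?v_neq //; exact: NV.
Qed.
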